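(* Let $\mathsf{A}\in\mathbb{R}^{n\times n\times\cdots\times n\times n}$ be an even-order supersymmetric tensor, of order $2k$. Then the Z-spectral radius of $\mathsf{A}$ is upper bounded by the spectral radius of the unfolded matrix $\mathbf{A}=\psi(\mathsf{A})\in\mathbb{R}^{n^k\times n^k}$ defined by $$\mathsf{A}_{j_1i_1j_2i_2\dots j_ki_k}\xrightarrow{\ \psi\ }\mathbf{A}_{ji},\qquad j=j_1+\sum_{p=2}^k(j_p-1)n^{p-1},\quad i=i_1+\sum_{p=2}^k(i_p-1)n^{p-1},$$ for $j_1,\dots,j_k,i_1,\dots,i_k\in\{1,\dots,n\}$.
   Context: A tensor $\mathsf{T}\in\mathbb{R}^{n\times\cdots\times n}$ of order $m$ ($m$ modes, each of size $n$) is supersymmetric if its entries $\mathsf{T}_{j_1j_2\dots j_m}$ are invariant under any permutation of the indices. For a vector $\mathbf{v}$, the vector $\mathsf{T}\mathbf{v}^{m-1}$ is given by $(\mathsf{T}\mathbf{v}^{m-1})_{j}=\sum_{j_1,\dots,j_{m-1}=1}^n\mathsf{T}_{j_1\dots j_{m-1}j}\,\mathbf{v}_{j_1}\cdots\mathbf{v}_{j_{m-1}}$. For a supersymmetric tensor $\mathsf{T}$ of order $m$, the E-eigenvalues $\lambda\in\mathbb{C}$ and E-eigenvectors $\mathbf{v}\in\mathbb{C}^n$ of $\mathsf{T}$ are defined by $\mathsf{T}\mathbf{v}^{m-1}=\lambda\mathbf{v}$ and $\mathbf{v}^\top\mathbf{v}=1$. The E-eigenvalues may be complex; an E-eigenvalue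 $\lambda$ that is real is called a Z-eigenvalue. The Z-spectral radius of a supersymmetric tensor is the maximum of the absolute values of all its Z-eigenvalues. The spectral radius of a square matrix is the maximum of the absolute values of its eigenvalues.
   Formalization: Z-eigenvalues are taken to be real E-eigenvalues having a real E-eigenvector; if a real E-eigenvalue with only non-real E-eigenvectors also counted, the bound would fail (for example, for some supersymmetric tensors of order 4 with n = 2). *)

(* Defs.v *)
From HB Require Import structures.
From mathcomp Require Import all_boot all_order all_fingroup all_algebra.
From mathcomp Require Import all_classical all_reals.
From mathcomp Require Import complex.

Set Implicit Arguments.
Unset Strict Implicit.
Unset Printing Implicit Defensive.

Import Order.TTheory GRing.Theory Num.Theory.

Local Open Scope classical_set_scope.
Local Open Scope ring_scope.

(* All indices are 0-based: 'I_n = {0, ..., n-1} replaces {1, ..., n}. *)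
Definition multi_index (m n : nat) := {ffun 'I_m -> 'I_n}.

Definition tensor (F : Type) (m n : nat) := multi_index m n -> F.

Definition supersymmetric (F : Type) (m n : nat) (T : tensor F m n) : Prop :=
  forall (s : 'S_m) (f : multi_index m n), T [ffun p => f (s p)] = T f.

(* (f_1, ..., f_(m-1), j): [insub p] is [None] only at the last position. *)
Definition index_rcons (m n : nat) (f : multi_index m.-1 n) (j : 'I_n) :
    multi_index m n :=
  [ffun p : 'I_m => oapp f j (insub (val p))].

(* T v^(m-1), for a tensor of order m > 0 *)
Definition tensor_apply (F : comNzRingType) (m n : nat) (T : tensor F m n)
    (v : 'cV[F]_n) : 'cV[F]_n :=
  \col_j \sum_(f : multi_index m.-1 n)
    T (index_rcons f j) * \prod_(p < m.-1) v (f p) 0.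

(* The normalisation is v^T v = 1 without conjugation. *)
Definition E_eigenpair (R : realType) (m n : nat) (T : tensor R m n)
    (lambda : R[i]) (v : 'cV[R[i]]_n) : Prop :=
  tensor_apply (fun f => (T f)%:C%C) v = lambda *: v /\ v^T *m v = 1%:M.

(* Z-eigenvalues are the E-eigenvalues of real E-eigenpairs.  A real
   E-eigenvalue may have only non-real E-eigenvectors: it is not a
   Z-eigenvalue. *)
Definition Z_eigenvalue (R : realType) (m n : nat) (T : tensor R m n)
    (lambda : R) : Prop :=
  exists v : 'cV[R]_n,
    E_eigenpair T lambda%:C%C (map_mx (real_complex R) v).

(* The suprema below are maxima: for n > 0 and T supersymmetric of even order
   m > 0, the set of moduli of Z-eigenvalues is non-empty and compact. *)
Definition Z_spectral_radius (R : realType) (m n : nat) (T : tensor R m n) : R :=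
  sup [set `|lambda| | lambda in Z_eigenvalue T].

(* The eigenvalues of the real matrix M are taken in the complex field; for
   N > 0 there are finitely many of them, and at least one. *)
Definition spectral_radius (R : realType) (N : nat) (M : 'M[R]_N) : R :=
  sup [set r : R | exists2 z : R[i],
    eigenvalue (map_mx (real_complex R) M) z & `|z| = r%:C%C].

Lemma half_ord_subproof (k : nat) (p : 'I_(2 * k)) : (p./2 < k)%N.
Proof. by rewrite ltn_half_double -mul2n. Qed.

Definition half_ord (k : nat) (p : 'I_(2 * k)) : 'I_k :=
  Ordinal (half_ord_subproof p).

(* (j_1, i_1, j_2, i_2, ..., j_k, i_k) *)
Definition interleave (k n : nat) (j i : multi_index k n) :
    multi_index (2 * k) n :=
  [ffun p : 'I_(2 * k) => if odd p then i (half_ord p) else j (half_ord p)].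

(* 0-based form of j_1 + sum_(2 <= p <= k) (j_p - 1) n^(p-1) *)
Definition encode (k n : nat) (j : multi_index k n) : nat :=
  (\sum_(p < k) j p * n ^ p)%N.

Lemma decode_subproof (k n : nat) (j : 'I_(n ^ k)) (p : 'I_k) :
  ((j %/ n ^ p) %% n < n)%N.
Proof.
rewrite ltn_mod; case: n j => [|//] [j]; case: k p => [[]//|k _].
by rewrite exp0n.
Qed.

Definition decode (k n : nat) (j : 'I_(n ^ k)) : multi_index k n :=
  [ffun p => Ordinal (decode_subproof j p)].

Definition unfolding (F : Type) (k n : nat) (A : tensor F (2 * k) n) :
    'M[F]_(n ^ k) :=
  \matrix_(j, i) A (interleave (decode j) (decode i)).

Lemma encode_lt (k n : nat) (j : multi_index k n) : (encode j < n ^ k)%N.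
Proof.
rewrite /encode; elim: k j => [|k IHk] j; first by rewrite big_ord0.
rewrite big_ord_recr /= expnSr.
pose j' : multi_index k n := [ffun p => j (widen_ord (leqnSn k) p)].
have -> : (\sum_(p < k) j (widen_ord (leqnSn k) p) * n ^ p =
           \sum_(p < k) j' p * n ^ p)%N.
  by apply: eq_bigr => p _; rewrite ffunE.
apply: (@leq_trans (n ^ k + j ord_max * n ^ k)%N).
  by rewrite ltn_add2r IHk.
by rewrite -mulSn mulnC leq_mul2l ltn_ord orbT.
Qed.

Definition encode_ord (k n : nat) (j : multi_index k n) : 'I_(n ^ k) :=
  Ordinal (encode_lt j).

Lemma encode_ordK (k n : nat) : cancel (@encode_ord k n) (@decode k n).
Proof.
move=> j; apply/ffunP => p; rewrite ffunE; apply: val_inj => /=.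
rewrite /encode; elim: k j p => [|k IHk] j p; first by case: p.
have n0 : (0 < n)%N by case: n j {IHk} => [|//] j; case: (j p).
rewrite big_ord_recl /= expn0 muln1.
pose j' : multi_index k n := [ffun q => j (lift ord0 q)].
have -> : (\sum_(q < k) j (lift ord0 q) * n ^ bump 0 q =
           (\sum_(q < k) j' q * n ^ q) * n)%N.
  rewrite big_distrl /=; apply: eq_bigr => q _.
  by rewrite ffunE /bump /= add1n expnSr mulnA.
rewrite addnC.
case: (unliftP ord0 p) => [q|] ->.
  rewrite /= /bump /= add1n expnS divnMA divnMDl// (divn_small (ltn_ord _)) addn0.
  by rewrite IHk ffunE.
by rewrite /= expn0 divn1 modnMDl modn_small.
Qed.

Lemma unfoldingE (F : Type) (k n : nat) (A : tensor F (2 * k) n)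
    (j i : multi_index k n) :
  unfolding A (encode_ord j) (encode_ord i) = A (interleave j i).
Proof. by rewrite mxE !encode_ordK. Qed.

(* Main.v *)
(* For a unit Z-eigenvector v with eigenvalue lambda, the tensor power
   x = v (x) ... (x) v (k factors) is a unit vector of R^(n^k) whose Rayleigh
   quotient for the unfolding is lambda = v^T (A v^(2k-1)).  Exchanging each
   j_p with i_p is a permutation of the 2k indices of A, so the unfolding is a
   symmetric matrix, and the spectral theorem bounds its Rayleigh quotients by
   the spectral radius. *)
Require Import Defs.
From HB Require Import structures.
From mathcomp Require Import all_boot all_order all_fingroup all_algebra.
From mathcomp Require Import all_classical all_reals.
From mathcomp Require Import complex.
From mathcomp Require Import zify.

Import Order.TTheory GRing.Theory Num.Theory.

Local Open Scope classical_set_scope.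
Local Open Scope sesquilinear_scope.
Local Open Scope ring_scope.

(** Unitary diagonalisation: in the coordinates [w = u *m P^t*] the form becomes the sum of d_i
    |w_i|^2 and the squared norm the sum of |w_i|^2, with every |d_i| at most [r]. *)
Lemma normalmx_rayleigh_le {C : numClosedFieldType} {N : nat} {M : 'M[C]_N}
    {u : 'rV[C]_N} {r : C} :
  M \is normalmx -> (forall z, eigenvalue M z -> `|z| <= r) ->
  `|(u *m M *m u^t*) 0 0| <= r * (u *m u^t*) 0 0.
Proof.
move=> /orthomx_spectralP; set P := spectralmx M; set d := spectral_diag M.
move=> ME Mr; have PU : P \is unitarymx by exact: spectral_unitarymx.
have Pu : P \in unitmx by exact: unitarymx_unit.
have dr i : `|d 0 i| <= r.
  (* [eigenvalue] concerns row vectors, so the rows of [P] are the eigenvectors; they are nonzero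
     because [P] is invertible. *)
  apply: Mr; apply/eigenvalueP; exists (row i P).
    rewrite ME rowE !mulmxA mulmxK//.
    by rewrite -(rowE i (diag_mx d)) row_diag_mx -scalemxAl.
  rewrite rowE mulmx_free_eq0 ?row_free_unit//; apply/eqP.
  by move/matrixP/(_ 0 i)/eqP; rewrite !mxE !eqxx oner_eq0.
pose w := u *m P^t*.
have wE : w^t* = P *m u^t*.
  by rewrite /w trmx_mul map_mxM /= trmxCK.
have -> : u *m M *m u^t* = w *m diag_mx d *m w^t*.
  by rewrite wE {1}ME invmx_unitary// /w !mulmxA.
have -> : u *m u^t* = w *m w^t*.
  by rewrite wE /w -mulmxA -invmx_unitary// mulKmx.
rewrite !mxE mulr_sumr; apply: le_trans (ler_norm_sum _ _ _) _.
apply: ler_sum => i _; rewrite mul_mx_diag !mxE mulrAC -normCK normrM.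
by rewrite [`|_ ^+ 2|]ger0_norm ?exprn_ge0// mulrC ler_wpM2r ?exprn_ge0.
Qed.

Lemma eigenvalue_le_spectral_radius {R : realType} {N : nat} {M : 'M[R]_N}
    {z : R[i]} :
  eigenvalue (map_mx (real_complex R) M) z ->
  `|z| <= (spectral_radius M)%:C%C.
Proof.
set Mc := map_mx _ M => Mz.
have [rs rsE] := closed_field_poly_normal (char_poly Mc).
have mem_rs y : eigenvalue Mc y -> y \in rs.
  rewrite eigenvalue_root_char rsE rootZ ?root_prod_XsubC//.
  by rewrite lead_coef_eq0 -size_poly_eq0 size_char_poly.
have nE (y : R[i]) : `|y| = (complex.Re `|y|)%:C%C.
  by rewrite RRe_real// normr_real.
rewrite nE lecR /spectral_radius; apply: ub_le_sup; last by exists z.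
(* [sup] dominates the set only if it is bounded: every eigenvalue is a root of the characteristic
   polynomial, so the sum of the moduli of all roots is a bound. *)
exists (\sum_(y <- rs) complex.Re `|y|) => r /= [y /mem_rs yrs yr].
have -> : r = complex.Re `|y| by rewrite yr.
rewrite (big_rem y)//= lerDl sumr_ge0// => x _.
by rewrite -ler0c -nE.
Qed.

Lemma spectral_radius_ge0 {R : realType} {N : nat} (M : 'M[R]_N) :
  (0 < N)%N -> 0 <= spectral_radius M.
Proof.
move=> N0; have [z Mz] := eigenvalue_closed (map_mx (real_complex R) M) N0.
by rewrite -ler0c; apply: le_trans (eigenvalue_le_spectral_radius Mz).
Qed.

(** [encode_ord] is injective between sets of the same size n^k, hence a bijection, and [decode]
    undoes it. *)
Lemma sum_decode {F : comNzRingType} {n k : nat}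
    (G : multi_index k n -> F) :
  \sum_(j < n ^ k) G (Defs.decode j) = \sum_(j : multi_index k n) G j.
Proof.
have [g gK Kg] : bijective (@encode_ord k n).
  apply: inj_card_bij; first exact: can_inj (@encode_ordK k n).
  by rewrite card_ffun !card_ord.
rewrite (reindex (@encode_ord k n)); last by exists g => x _.
by apply: eq_bigr => j _; rewrite encode_ordK.
Qed.

Definition tensor_power {F : comNzRingType} {n : nat} (k : nat) (v : 'cV[F]_n) :
    'rV[F]_(n ^ k) := \row_a \prod_(p < k) v (Defs.decode a p) 0.

Lemma tensor_power_norm {F : comNzRingType} {n : nat} (k : nat)
    (v : 'cV[F]_n) :
  (tensor_power k v *m (tensor_power k v)^T) 0 0 = ((v^T *m v) 0 0) ^+ k.
Proof.
rewrite !mxE.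
transitivity (\sum_(a < n ^ k) \prod_(p < k) (v (Defs.decode a p) 0 ^+ 2)).
  by apply: eq_bigr => a _; rewrite !mxE -big_split.
rewrite (sum_decode (fun j => \prod_(p < k) (v (j p) 0 ^+ 2))).
(* Distributivity: the sum over multi-indices factors into k equal sums, one per position. *)
rewrite -(bigA_distr_bigA (fun=> fun i => v i 0 ^+ 2)) prodr_const card_ord.
by congr (_ ^+ _); apply: eq_bigr => i _; rewrite !mxE.
Qed.

(** The homogeneous form T v^m, the link between the eigenvalue equation and the quadratic form of
    the unfolding. *)
Definition tensor_form {F : comNzRingType} {m n : nat} (T : tensor F m n)
    (v : 'cV[F]_n) : F :=
  \sum_(f : multi_index m n) T f * \prod_(p < m) v (f p) 0.

Lemma tensor_apply_form {F : comNzRingType} {m n : nat} (T : tensor F m n)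
    (v : 'cV[F]_n) :
  (0 < m)%N -> (v^T *m tensor_apply T v) 0 0 = tensor_form T v.
Proof.
case: m T => // m T _; rewrite mxE /tensor_form.
have rcons_max (f : multi_index m n) j : @index_rcons m.+1 n f j ord_max = j.
  by rewrite ffunE insubN//= ltnn.
have rcons_widen (f : multi_index m n) j p :
    @index_rcons m.+1 n f j (widen_ord (leqnSn m) p) = f p.
  by rewrite ffunE insubT//= => pm; congr (f _); apply: val_inj.
(* [h] appends the last index and [h'] splits it off, which turns the sum over all multi-indices
   into a double sum. *)
pose h (q : 'I_n * multi_index m n) := @index_rcons m.+1 n q.2 q.1.
pose h' (f : multi_index m.+1 n) : 'I_n * multi_index m n :=
  (f ord_max, [ffun p => f (widen_ord (leqnSn m) p)]).
rewrite (reindex h) /=; last first.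
  exists h' => [[j f] _|f _].
    by rewrite /h /h' rcons_max; congr pair; apply/ffunP=> p; rewrite ffunE.
  apply/ffunP => p; case: (unliftP ord_max p) => [q|] ->; last exact: rcons_max.
  have -> : lift ord_max q = widen_ord (leqnSn m) q.
    by apply: val_inj; rewrite /= /bump leqNgt ltn_ord.
  by rewrite /h rcons_widen ffunE.
rewrite -(pair_bigA _ (fun j f => T (h (j, f)) * \prod_p v (h (j, f) p) 0)) /=.
apply: eq_bigr => j _; rewrite !mxE mulr_sumr; apply: eq_bigr => f _.
rewrite big_ord_recr /= rcons_max mulrC -mulrA; congr (_ * (_ * _)).
by apply: eq_bigr => p _; rewrite rcons_widen.
Qed.

Lemma double_bound {k : nat} (q : 'I_k) (b : bool) : (q.*2 + b < 2 * k)%N.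
Proof. by case: q b => q qk []/=; lia. Qed.

Definition double_ord {k : nat} (q : 'I_k) (b : bool) : 'I_(2 * k) :=
  Ordinal (double_bound q b).

Lemma half_double_ord {k : nat} (q : 'I_k) (b : bool) :
  half_ord (double_ord q b) = q.
Proof. by apply: val_inj; case: b => /=; lia. Qed.

Lemma odd_double_ord {k : nat} (q : 'I_k) (b : bool) :
  odd (double_ord q b) = b.
Proof. by rewrite /= oddD odd_double; case: b. Qed.

Lemma double_half_ord {k : nat} (p : 'I_(2 * k)) :
  double_ord (half_ord p) (odd p) = p.
Proof. by apply: val_inj; rewrite /= addnC odd_double_half. Qed.

Lemma interleave_double {k n : nat} (j i : multi_index k n) q b :
  interleave j i (double_ord q b) = if b then i q else j q.
Proof. by rewrite ffunE odd_double_ord half_double_ord. Qed.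

Lemma unfolding_form {F : comNzRingType} {n k : nat} (A : tensor F (2 * k) n)
    (v : 'cV[F]_n) :
  (tensor_power k v *m unfolding A *m (tensor_power k v)^T) 0 0 =
  tensor_form A v.
Proof.
pose m (j : multi_index k n) := \prod_(p < k) v (j p) 0.
pose G i j := A (interleave j i) * (m j * m i).
rewrite mxE.
transitivity (\sum_(b < n ^ k) \sum_(a < n ^ k)
    G (Defs.decode b) (Defs.decode a)).
  apply: eq_bigr => b _; rewrite !mxE mulr_suml; apply: eq_bigr => a _.
  by rewrite !mxE mulrAC mulrC.
under eq_bigr do rewrite sum_decode.
rewrite (sum_decode (fun i => \sum_j G i j)) pair_bigA /tensor_form.
(* A multi-index of length 2k is the interleaving of its restrictions to even and to odd
   positions. *)
rewrite [RHS](reindex (fun q => interleave q.2 q.1)) /=; last first.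
  exists (fun f : multi_index (2 * k) n =>
    ([ffun q => f (double_ord q true)], [ffun q => f (double_ord q false)])).
    by case=> i j _; congr pair; apply/ffunP => q;
      rewrite ffunE interleave_double.
  move=> f _; apply/ffunP => p; rewrite -(double_half_ord p) interleave_double.
  by case: (odd p); rewrite ffunE.
apply: eq_bigr => -[i j] _; rewrite /G /=; congr (_ * _).
(* Positions are grouped into pairs 2q, 2q+1, so that each pair contributes the factors of j_q and
   i_q. *)
rewrite (reindex (fun q => double_ord q.1 q.2)) /=; last first.
  exists (fun p => (half_ord p, odd p)) => [[q b] _|p _].
    by rewrite half_double_ord odd_double_ord.
  exact: double_half_ord.
rewrite -(pair_bigA _ (fun q b => v (interleave j i (double_ord q b)) 0)) /=.
rewrite -big_split /=; apply: eq_bigr => q _.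
by rewrite big_bool !interleave_double mulrC.
Qed.

Lemma unfolding_sym {F : Type} {n k : nat} {A : tensor F (2 * k) n} :
  supersymmetric A -> (unfolding A)^T = unfolding A.
Proof.
move=> hA; apply/matrixP => a b; rewrite !mxE.
(* [flip] exchanges the positions 2q and 2q+1. *)
pose flip (p : 'I_(2 * k)) := double_ord (half_ord p) (~~ odd p).
have flipK : involutive flip.
  move=> p; rewrite /flip half_double_ord odd_double_ord negbK.
  exact: double_half_ord.
rewrite -(hA (perm (inv_inj flipK))); congr (A _); apply/ffunP => p.
rewrite ffunE permE /flip interleave_double -[in RHS](double_half_ord p).
by rewrite interleave_double; case: (odd p).
Qed.

Theorem lemma1 (R : realType) (n k : nat) (hn : (0 < n)%N) (hk : (0 < k)%N)
    (A : tensor R (2 * k) n) (hA : supersymmetric A) :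
  Z_spectral_radius A <= spectral_radius (unfolding A).
Proof.
rewrite /Z_spectral_radius; set E := [set _ | _ in _].
(* An empty set has [sup] 0 by convention, so nonnegativity of the spectral radius settles that
   case. *)
have [->|] := eqVneq E set0.
  by rewrite sup0 spectral_radius_ge0// expn_gt0 hn.
move=> /set0P E0; apply: ge_sup => // _ [lambda [v [vE v1]] <-].
set vc := map_mx _ v in vE v1; set M := unfolding A.
pose Ac : tensor R[i] (2 * k) n := fun f => (A f)%:C%C.
have unfAc : unfolding Ac = map_mx (real_complex R) M.
  by apply/matrixP => a b; rewrite !mxE.
(* For real matrices the adjoint is the transpose: this makes the symmetric unfolding normal and
   identifies the normalisation v^T v = 1 with the Hermitian one. *)
have conj_real m' n' (B : 'M[R[i]]_(m', n')) : B \is a realmx -> B^t* = B^T.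
  move=> Br; rewrite realmxC//; apply/mxOverP => a b.
  by rewrite mxE (mxOverP Br).
have real_of (x : R) : x%:C%C \is Num.real by apply/complex_realP; exists x.
have Mr : map_mx (real_complex R) M \is a realmx.
  by apply/mxOverP => a b; rewrite mxE real_of.
have Mn : map_mx (real_complex R) M \is normalmx.
  by apply/normalmxP; rewrite conj_real// map_trmx /M unfolding_sym.
pose x := tensor_power k vc.
have xr : x \is a realmx.
  by apply/mxOverP => a b; rewrite mxE rpred_prod// => p _; rewrite mxE real_of.
have := normalmx_rayleigh_le (u := x) Mn
  (fun z => @eigenvalue_le_spectral_radius R _ M z).
have one11 : (1%:M : 'M[R[i]]_1) 0 0 = 1 by rewrite mxE.
rewrite conj_real// tensor_power_norm v1 one11 expr1n mulr1.
rewrite -unfAc unfolding_form.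
(* The form equals v^T (lambda v) = lambda. *)
rewrite -tensor_apply_form ?muln_gt0//= vE -scalemxAr v1 mxE one11 mulr1.
by rewrite normc_def /= expr0n addr0 sqrtr_sqr lecR.
Qed.
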